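(* Assume that $\mathcal{X}\subset\mathbb{R}^{d_x}$ and $\mathcal{Y}\subset\mathbb{R}^{d_y}$ are compact sets, let $\mu\in\mathcal{P}(\mathcal{X})$, $\nu\in\mathcal{P}(\mathcal{Y})$, and let $c:\mathcal{X}\times\mathcal{Y}\to\mathbb{R}_+\cup\{+\infty\}$ be lower semi-continuous. Let $(\phi_m)_{m\in\mathbb{N}^*}\subset L^\infty(\mathcal{X})$ and $(\psi_n)_{n\in\mathbb{N}^*}\subset L^\infty(\mathcal{Y})$ be sequences of bounded measurable real-valued functions such that $$\forall f\in C^0(\mathcal{X}),\quad\inf_{v_N\in\mathrm{Span}\{\phi_m,\,1\le m\le N\}}\|f-v_N\|_\infty\xrightarrow[N\to+\infty]{}0,$$ $$\forall f\in C^0(\mathcal{Y}),\quad\inf_{v_N\in\mathrm{Span}\{\psi_n,\,1\le n\le N\}}\|f-v_N\|_\infty\xrightarrow[N\to+\infty]{}0.$$ Let $I=\inf_{\pi\in\Pi(\mu,\nu)}\int_{\mathcal{X}\times\mathcal{Y}}c\,d\pi$ and, for $N\in\mathbb{N}^*$, $I^N=\inf\{\int_{\mathcal{X}\times\mathcal{Y}}c\,d\pi:\pi\in\Pi(\mu,\nu;(\phi_m)_{1\le m\le N},(\psi_n)_{1\le n\le N})\}$. Assume that $I<+\infty$. Then $I^N\le I$ and $I^N\to I$ as $N\to\infty$. Moreover, from every sequence $(\pi^N)_{N\in\mathbb{N}^*}$ such that for all $N\in\mathbb{N}^*$, $\pi^N\in\Pi(\mu,\nu;(\phi_m)_{1\le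 m\le N},(\psi_n)_{1\le n\le N})$ satisfies $$\int_{\mathcal{X}\times\mathcal{Y}}c(x,y)\,d\pi^N(x,y)\le I^N+\epsilon_N,$$ with $\epsilon_N\to0$ as $N\to+\infty$, one can extract a subsequence which converges (weakly) towards a measure $\pi^\infty\in\mathcal{P}(\mathcal{X}\times\mathcal{Y})$ which is a minimizer of the problem defining $I$.
   Context: $\mathbb{N}^*=\{1,2,\dots\}$, $\mathbb{R}_+=[0,+\infty)$, $d_x,d_y\in\mathbb{N}^*$. $\mathcal{P}(E)$ is the set of Borel probability measures on $E$. $C^0(E)$ is the set of real-valued continuous functions on $E$ and $\|\cdot\|_\infty$ is the supremum norm. $\Pi(\mu,\nu)$ is the set of probability measures on $\mathcal{X}\times\mathcal{Y}$ with marginal laws $\mu$ and $\nu$. $\Pi(\mu,\nu;(\phi_m)_{1\le m\le N},(\psi_n)_{1\le n\le N})$ is the set of $\pi\in\mathcal{P}(\mathcal{X}\times\mathcal{Y})$ such that for all $1\le m,n\le N$: $\int\phi_m(x)\,d\pi(x,y)=\int_{\mathcal{X}}\phi_m\,d\mu$ and $\int\psi_n(y)\,d\pi(x,y)=\int_{\mathcal{Y}}\psi_n\,d\nu$. *)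

(* Defs.v *)
From HB Require Import structures.
From mathcomp Require Import all_boot all_order all_algebra.
From mathcomp Require Import all_classical all_reals all_analysis.

Set Implicit Arguments.
Unset Strict Implicit.
Unset Printing Implicit Defensive.

Import Order.TTheory GRing.Theory Num.Theory.
Import numFieldNormedType.Exports.

Local Open Scope classical_set_scope.
Local Open Scope ring_scope.

(* The library makes products topological and pointed, but not jointly so. *)
HB.instance Definition _ (S T : ptopologicalType) := Pointed.on (S * T)%type.

(* T equipped with its Borel sigma-algebra. *)
Notation borel T := (g_sigma_algebraType (@open T)).

(* A Borel probability measure on a Borel set E of T is represented by the
   Borel probability measure on T, concentrated on E, that extends it. In the
   same way a function on E is represented by a function on T, of which only
   the values on E matter. *)
Definition prob_on (R : realType) (T : ptopologicalType) (E : set T) :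
    set (probability (borel T) R) :=
  [set P | P E = 1%E].

Definition weak_cvg (R : realType) (T : ptopologicalType) (E : set T)
    (P_ : nat -> probability (borel T) R) (P : probability (borel T) R) : Prop :=
  forall f : T -> R, {within E, continuous f} -> [bounded f x | x in E] ->
    (fun k => \int[P_ k]_(x in E) (f x)%:E)%E @ \oo -->
      (\int[P]_(x in E) (f x)%:E)%E.

Definition sup_norm (R : realType) (T : Type) (E : set T) (g : T -> R) :
    \bar R :=
  ereal_sup [set `|g x|%:E | x in E].

(* Sequences indexed by {1, 2, ...} are functions on nat whose value at 0 is
   never used. *)
Definition span_upto (R : realType) (T : Type) (phi : nat -> T -> R) (N : nat) :
    set (T -> R) :=
  [set v | exists a : nat -> R,
     v = (fun x => \sum_(1 <= m < N.+1) a m * phi m x)].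

Definition span_dense (R : realType) (T : topologicalType) (E : set T)
    (phi : nat -> T -> R) : Prop :=
  forall f : T -> R, {within E, continuous f} ->
    (fun N => ereal_inf [set sup_norm E (f \- v) | v in span_upto phi N])
      @ \oo --> 0%E.

Section transport.
Variables (R : realType) (S T : ptopologicalType) (X : set S) (Y : set T).
Variables (mu : probability (borel S) R) (nu : probability (borel T) R).

Definition plans : set (probability (borel (S * T)%type) R) :=
  [set P | [/\ prob_on (X `*` Y) P,
    forall A : set (borel S), measurable A ->
      pushforward P (fst : borel (S * T)%type -> borel S) A = mu A &
    forall B : set (borel T), measurable B ->
      pushforward P (snd : borel (S * T)%type -> borel T) B = nu B]].

Definition moment_plans (phi : nat -> S -> R) (psi : nat -> T -> R) (N : nat) :
    set (probability (borel (S * T)%type) R) :=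
  [set P | prob_on (X `*` Y) P /\
    forall m n, (1 <= m <= N)%N -> (1 <= n <= N)%N ->
      (\int[P]_(z in X `*` Y) (phi m z.1)%:E = \int[mu]_(x in X) (phi m x)%:E)%E
      /\
      (\int[P]_(z in X `*` Y) (psi n z.2)%:E = \int[nu]_(y in Y) (psi n y)%:E)%E].

Definition cost (c : S * T -> \bar R) (P : probability (borel (S * T)%type) R) :
    \bar R :=
  (\int[P]_(z in X `*` Y) c z)%E.

Definition ot_value (c : S * T -> \bar R) : \bar R :=
  ereal_inf [set cost c P | P in plans].

Definition mc_value (c : S * T -> \bar R) (phi : nat -> S -> R)
    (psi : nat -> T -> R) (N : nat) : \bar R :=
  ereal_inf [set cost c P | P in moment_plans phi psi N].

End transport.

(* Main.v *)
(** Tightness is free on the compact set K = X x Y: along an ultrafilter finer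
    than [\oo] the plans converge setwise to a finitely additive content, whose
    inner regularization on open sets, extended by Caratheodory, is a Borel
    probability P with P G <= lim P_n G for every open G.  A countable base of K
    turns the ultrafilter into a subsequence with P G <= liminf P_(s k) G, and
    the layer-cake formula with Fatou's lemma upgrades this to
    int c dP <= liminf int c dP_(s k) for every lower semicontinuous c >= 0 on
    K, hence to weak convergence.  Approximating continuous functions uniformly
    by the test functions shows that P has the marginals mu and nu.  Applied to
    near-minimizers, this gives I <= int c dP <= sup I^N <= I. *)
Require Import Defs.
From HB Require Import structures.
From mathcomp Require Import all_boot all_order all_algebra.
From mathcomp Require Import finmap.
From mathcomp Require Import all_classical all_reals all_analysis.
From mathcomp Require Import measurable_realfun.
Import Order.TTheory GRing.Theory Num.Theory.
Import numFieldNormedType.Exports.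
Local Open Scope classical_set_scope.
Local Open Scope ring_scope.

Set Implicit Arguments.
Unset Strict Implicit.
Unset Printing Implicit Defensive.

(** * Probabilities from contents on closed sets *)

Section closed_content.
Context (R : realType) (T : ptopologicalType) (K : set T) (L : set T -> R).
Hypotheses (normT : normal_space T) (cptK : compact K) (clK : closed K).
Hypothesis L_set0 : L set0 = 0.
Hypothesis le_L : forall C D, closed C -> closed D -> C `<=` D -> L C <= L D.
Hypothesis L_setU_le : forall C D, closed C -> closed D ->
  L (C `|` D) <= L C + L D.
Hypothesis L_setU_ge : forall C D, closed C -> closed D -> C `&` D = set0 ->
  L C + L D <= L (C `|` D).
Hypothesis L_setI : forall C, closed C -> L C <= L (C `&` K).

(** The content [L] is only finitely additive, and [L_setI] says that it charges nothing outside
    [K]. Taking suprema over closed subsets of an open set is what turns compactness of [K] into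
    countable subadditivity. *)
Definition inner_content (G : set T) : \bar R :=
  ereal_sup [set (L C)%:E | C in [set C | closed C /\ C `<=` G]].

(** The outer measure generated by the values on open sets, as in the construction behind the Riesz
    representation theorem. *)
Definition outer_content (A : set T) : \bar R :=
  ereal_inf [set inner_content G | G in [set G | open G /\ A `<=` G]].

Local Open Scope ereal_scope.

Lemma inner_content_ub C G : closed C -> C `<=` G ->
  (L C)%:E <= inner_content G.
Proof. by move=> clC CG; apply: ereal_sup_ubound; exists C. Qed.

Lemma inner_content_ge0 G : 0 <= inner_content G.
Proof.
rewrite -[leLHS]/(0%R%:E) -L_set0.
by apply: inner_content_ub => //; exact: closed0.
Qed.

Lemma inner_content_le G (M : \bar R) :
  (forall C, closed C -> C `<=` G -> (L C)%:E <= M) -> inner_content G <= M.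
Proof.
by move=> h; apply: ge_ereal_sup => _ [C [clC CG] <-]; exact: h.
Qed.

Lemma le_inner_content G H : G `<=` H -> inner_content G <= inner_content H.
Proof.
move=> GH; apply: inner_content_le => C clC CG.
by apply: inner_content_ub => //; exact: subset_trans GH.
Qed.

(** Normality separates [C \ G] and [C \ H] by disjoint open sets [U] and [V]. Then [C] is the union
    of the closed sets [C \ U], contained in [G], and [C \ V], contained in [H]. *)
Lemma inner_contentU G H : open G -> open H ->
  inner_content (G `|` H) <= inner_content G + inner_content H.
Proof.
move=> oG oH; apply: inner_content_le => C clC CGH.
have clDG : closed (C `\` G) by apply: closedI => //; exact: open_closedC.
have clDH : closed (C `\` H) by apply: closedI => //; exact: open_closedC.
have dis : (C `\` G) `&` (C `\` H) = set0.
  by rewrite -subset0 => x [[Cx nGx] [_ nHx]]; case: (CGH x Cx).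
have [U [V [oU oV CU CV UV]]] :=
  (@normal_openP R T).1 normT _ _ clDG clDH dis.
have clCU : closed (C `\` U) by apply: closedI => //; exact: open_closedC.
have clCV : closed (C `\` V) by apply: closedI => //; exact: open_closedC.
apply: (@le_trans _ _ ((L (C `\` U))%:E + (L (C `\` V))%:E)).
  rewrite -EFinD lee_fin; apply: le_trans (L_setU_le clCU clCV).
  apply: le_L => //; first exact: closedU.
  move=> x Cx; have [Ux|nUx] := pselect (U x); last by left.
  right; split => // Vx.
  by move: UV; rewrite -subset0 => /(_ x); apply.
apply: leeD; apply: inner_content_ub => // x [Cx nx].
- by apply: contrapT => nG; apply: nx; apply: CU.
- by apply: contrapT => nG; apply: nx; apply: CV.
Qed.

Lemma inner_content_bigsetU (G : (set T)^nat) n : (forall i, open (G i)) ->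
  inner_content (\big[setU/set0]_(i < n) G i) <= \sum_(i < n) inner_content (G i).
Proof.
move=> oG; elim: n => [|n ih].
  rewrite !big_ord0; apply: inner_content_le => C _; rewrite subset0 => ->.
  by rewrite L_set0.
rewrite !big_ord_recr /=; apply: le_trans (leeD ih (lexx _)).
apply: inner_contentU => //; rewrite -bigcup_mkord.
by apply: bigcup_open => i _; exact: oG.
Qed.

(** A closed [C] inside the union may be replaced by [C & K], which is compact and so covered by
    finitely many [G i]. Finite subadditivity finishes. *)
Lemma inner_content_bigcup (G : (set T)^nat) : (forall i, open (G i)) ->
  inner_content (\bigcup_i G i) <= \sum_(i <oo) inner_content (G i).
Proof.
move=> oG; apply: inner_content_le => C clC CG.
have cptCK : compact (C `&` K) by rewrite setIC; exact: compact_closedI.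
have : cover_compact (C `&` K) by rewrite -compact_cover.
move=> /(_ nat setT G (fun i _ => oG i)) [x [/CG [i _ Gix] _]|D _ CD].
  by exists i.
pose n := (\max_(i <- enum_fset D) i).+1.
apply: (@le_trans _ _ (L (C `&` K))%:E); first by rewrite lee_fin L_setI.
apply: (@le_trans _ _ (inner_content (\big[setU/set0]_(i < n) G i))).
  apply: inner_content_ub; first exact: closedI.
  move=> x /CD [i /= iD Gix]; rewrite -bigcup_mkord; exists i => //=.
  by rewrite ltnS; apply: leq_bigmax_seq.
apply: le_trans (inner_content_bigsetU n oG) _.
rewrite -(big_mkord xpredT (fun i => inner_content (G i))).
by apply: nneseries_lim_ge => i _ _; exact: inner_content_ge0.
Qed.

Lemma outer_content_open G : open G -> outer_content G = inner_content G.
Proof.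
move=> oG; apply/eqP; rewrite eq_le; apply/andP; split.
  by apply: ereal_inf_lbound; exists G; split.
by apply: le_ereal_inf_tmp => _ [H [oH GH] <-]; exact: le_inner_content.
Qed.

Lemma outer_content0 : outer_content set0 = 0.
Proof.
rewrite outer_content_open; last exact: open0.
apply/eqP; rewrite eq_le inner_content_ge0 andbT.
by apply: inner_content_le => C _; rewrite subset0 => ->; rewrite L_set0.
Qed.

Lemma outer_content_ge0 A : 0 <= outer_content A.
Proof. by apply: le_ereal_inf_tmp => _ [H _ <-]; exact: inner_content_ge0. Qed.

Lemma le_outer_content : {homo outer_content : A B / A `<=` B >-> A <= B}.
Proof.
move=> A B AB; apply: ereal_inf_le_tmp => _ [H [oH BH] <-].
by exists H => //; split => //; exact: subset_trans BH.
Qed.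

Lemma inner_content_fin G : inner_content G \is a fin_num.
Proof.
rewrite ge0_fin_numE ?inner_content_ge0//; apply: (@le_lt_trans _ _ (L setT)%:E).
  by apply: inner_content_le => C clC _; rewrite lee_fin le_L//; exact: closedT.
exact: ltry.
Qed.

Lemma outer_content_fin A : outer_content A \is a fin_num.
Proof.
rewrite ge0_fin_numE ?outer_content_ge0//.
apply: (@le_lt_trans _ _ (inner_content setT)).
  by apply: ereal_inf_lbound; exists setT => //; split => //; exact: openT.
by rewrite -ge0_fin_numE ?inner_content_ge0// inner_content_fin.
Qed.

Lemma outer_content_approx A (e : R) : (0 < e)%R ->
  exists G, [/\ open G, A `<=` G & inner_content G <= outer_content A + e%:E].
Proof.
move=> e0; have [_ [G [oG AG] <-] /ltW h] :=
  lb_ereal_inf_adherent e0 (outer_content_fin A).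
by exists G.
Qed.

Lemma outer_content_sigma_subadditive : sigma_subadditive outer_content.
Proof.
move=> F; apply/lee_addgt0Pr => e e0.
have h n : exists G, [/\ open G, F n `<=` G &
    inner_content G <= outer_content (F n) + (e / (2 ^ n.+1)%:R)%:E].
  by apply: outer_content_approx; rewrite divr_gt0// ltr0n expn_gt0.
pose G n := projT1 (cid (h n)).
have oG n : open (G n) by rewrite /G; case: cid => ? [].
have FG n : F n `<=` G n by rewrite /G; case: cid => ? [].
have hG n : inner_content (G n) <= outer_content (F n) + (e / (2 ^ n.+1)%:R)%:E.
  by rewrite /G; case: cid => ? [].
apply: (@le_trans _ _ (inner_content (\bigcup_n G n))).
  apply: ereal_inf_lbound; exists (\bigcup_n G n) => //.
  by split; [exact: bigcup_open|exact: subset_bigcup].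
apply: le_trans (inner_content_bigcup oG) _.
apply: le_trans (epsilon_trick _ _ (ltW e0)); last first.
  by move=> *; exact: outer_content_ge0.
by apply: lee_nneseries => // n _ _; exact: inner_content_ge0.
Qed.

(** Enclose [A] in an open [G], pick a closed [D] nearly exhausting [G \ C], then a closed [E]
    nearly exhausting [G \ D], a set that contains [G & C]. As [D] and [E] are disjoint closed
    subsets of [G], superadditivity of [L] bounds the sum of their contents by that of [G]. *)
Lemma outer_content_closed C A : closed C ->
  outer_content (A `&` C) + outer_content (A `&` ~` C) <= outer_content A.
Proof.
move=> clC; apply: le_ereal_inf_tmp => _ [G [oG AG] <-].
have oGC : open (G `\` C) by apply: openI => //; exact: closed_openC.
apply: (@le_trans _ _ (outer_content (G `&` C) + inner_content (G `\` C))).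
  by apply: leeD; rewrite -?outer_content_open//; apply: le_outer_content;
    exact: setSI.
apply/lee_addgt0Pr => e e0.
have e20 : (0 < e / 2)%R by rewrite divr_gt0.
have [_ [D [clD DG] <-] /ltW hD] :=
  ub_ereal_sup_adherent e20 (inner_content_fin (G `\` C)).
have [_ [E [clE EG] <-] /ltW hE] :=
  ub_ereal_sup_adherent e20 (inner_content_fin (G `\` D)).
have oGD : open (G `\` D) by apply: openI => //; exact: closed_openC.
have h : (L E)%:E + (L D)%:E <= inner_content G.
  apply: (@le_trans _ _ (L (E `|` D))%:E).
    rewrite -EFinD lee_fin; apply: L_setU_ge => //.
    by rewrite -subset0 => x [/EG [_ ?]].
  apply: inner_content_ub; first exact: closedU.
  by move=> x [/EG []|/DG []].
have h1 : outer_content (G `&` C) <= inner_content (G `\` D).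
  rewrite -outer_content_open//; apply: le_outer_content => x [Gx Cx].
  by split => // /DG [].
apply: (@le_trans _ _ ((L E)%:E + (e / 2)%:E + ((L D)%:E + (e / 2)%:E))).
  apply: leeD.
    by apply: le_trans h1 _; rewrite -leeBlDr.
  by rewrite -leeBlDr.
rewrite addeACA -[X in _ + X]EFinD -splitr.
exact: leeD.
Qed.

(** Closed sets split every set additively, so the sigma-algebra of Caratheodory measurable sets
    contains all Borel sets, and the outer content restricts to a measure there. *)
Lemma closed_content_probability : L setT = 1%R ->
  exists P : probability (borel T) R,
    forall G : set T, open G -> P G = inner_content G.
Proof.
move=> LT.
pose O : {outer_measure set T -> \bar R} :=
  HB.pack outer_content (isOuterMeasure.Build R T outer_content
    outer_content0 outer_content_ge0 le_outer_content
    outer_content_sigma_subadditive).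
have cara (A : set (borel T)) : measurable A -> O.-caratheodory A.
  have -> : @measurable _ (borel T) = <<s @open T >> by [].
  apply: smallest_sub.
    split; first exact: (caratheodory_measurable_set0 O).
    - by move=> B mB; rewrite setTD; exact: (@caratheodory_measurable_setC _ _ O).
    - exact: (@caratheodory_measurable_bigcup _ _ O).
  move=> G oG; rewrite -[G]setCK.
  apply: (@caratheodory_measurable_setC _ _ O).
  (* The reverse inequality is subadditivity of the outer measure. *)
  apply: le_caratheodory_measurable => X.
  exact: outer_content_closed (open_closedC oG).
have sadd : semi_sigma_additive (outer_content : set (borel T) -> \bar R).
  move=> F mF tF mUF.
  apply: (@caratheodory_measure_sigma_additive _ _ O) => //.
  - by move=> i; apply: cara.
  - exact: cara.
pose M : {measure set (borel T) -> \bar R} :=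
  HB.pack (outer_content : set (borel T) -> \bar R)
    (isMeasure.Build _ (borel T) R outer_content outer_content0
      outer_content_ge0 sadd).
have MT : M setT = 1.
  rewrite /M /= outer_content_open; last exact: openT.
  apply/eqP; rewrite eq_le; apply/andP; split.
    apply: inner_content_le => C clC _; by rewrite -LT lee_fin le_L.
  by rewrite -LT; apply: inner_content_ub => //; exact: (@closedT T).
pose P : probability (borel T) R :=
  HB.pack (outer_content : set (borel T) -> \bar R)
    (isMeasure.Build _ (borel T) R outer_content outer_content0
      outer_content_ge0 sadd) (Measure_isProbability.Build _ (borel T) R M MT).
by exists P => G oG; exact: outer_content_open.
Qed.

End closed_content.

(** * Sequential limits on a compact set *)

Lemma borel_open (T : ptopologicalType) (G : set T) :
  open G -> measurable (G : set (borel T)).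
Proof. by move=> oG; exact: sub_sigma_algebra. Qed.

Lemma borel_closed (T : ptopologicalType) (C : set T) :
  closed C -> measurable (C : set (borel T)).
Proof.
move=> clC; rewrite -[C]setCK.
by apply: measurableC; apply: borel_open; exact: closed_openC.
Qed.

Lemma probability_setI1 d (T : measurableType d) (R : realType)
    (P : probability T R) (K A : set T) : measurable K -> measurable A ->
  P K = 1%E -> P (A `&` K) = P A.
Proof.
move=> mK mA PK.
rewrite -[in RHS](setIT A) -(setUCr K) setIUr measureU//; last first.
- by rewrite setIACA setICr setI0.
- by apply: measurableI => //; exact: measurableC.
- exact: measurableI.
rewrite [X in (_ + X)%E](_ : _ = 0%E) ?adde0//.
apply/eqP; rewrite eq_le measure_ge0 andbT.
apply: (@le_trans _ _ (P (~` K))).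
  by apply: le_measure; rewrite ?inE//;
    [apply: measurableI => //|]; exact: measurableC.
by rewrite probability_setC// PK subee.
Qed.

Lemma limn_einf_ge (R : realType) (u : (\bar R)^nat) (x : \bar R) :
  (forall e : R, 0 < e -> \forall k \near \oo, (x <= u k + e%:E)%E) ->
  (x <= limn_einf u)%E.
Proof.
move=> h; apply/lee_addgt0Pr => e e0.
have [N _ hN] := h _ e0.
apply: (@le_trans _ _ (einfs u N + e%:E)%E).
  rewrite -leeBlDr//; apply: le_ereal_inf_tmp => _ [k /= Nk <-].
  by rewrite EFinN leeBlDr//; exact: hN.
rewrite leeD2r// limn_einf_lim (cvg_lim _ (@cvg_einfs_sup _ u))//.
by apply: ereal_sup_ubound; exists N.
Qed.

(** Compactness gives a cluster point [p]. For a neighbourhood [V] of [p], an ultrafilter contains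
    the preimage of [V] or its complement, and the latter contradicts clustering. *)
Lemma cvg_ultra_compact (T : topologicalType) (I : Type) (F : set_system I)
    (f : I -> T) (K : set T) : UltraFilter F -> compact K ->
  (\forall i \near F, K (f i)) -> exists2 p, K p & f @ F --> p.
Proof.
move=> UF cptK FK.
have [p [Kp clp]] := cptK (f @ F) _ FK.
exists p => // V nV; have [//|nFV] := in_ultra_setVsetC (f @^-1` V) UF.
have [x [nVx Vx]] := clp (~` V) V nFV nV.
by [].
Qed.

(** For each [n], finitely many balls of radius [1/(n+1)] cover [K]. Their interiors, over all [n]
    and all chosen centres, form the base. *)
Lemma compact_countable_base (R : realType) (T : pseudoMetricType R)
    (K : set T) : compact K ->
  exists U : (set T)^nat, (forall i, open (U i)) /\
    forall x G, K x -> open G -> G x -> exists2 i, U i x & U i `<=` G.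
Proof.
move=> cptK; have [->|/set0P[z0 Kz0]] := eqVneq K set0.
  by exists (fun=> set0); split => // i; exact: open0.
(* The point [z0] of [K] is the base point of [T'] and, below, the default value of [nth]. *)
pose T' : ptopologicalType := HB.pack T (isPointed.Build T z0).
have npos n : (0 : R) < n.+1%:R^-1 by [].
pose f n (z : T) : set T := interior (ball z n.+1%:R^-1).
have h n : finite_subset_cover [set: T] (f n) K.
  have : @cover_compact T K by have <- := congr1 (@^~ K) (@compact_cover T').
  apply.
  - by move=> z _; exact: open_interior.
  - by move=> z _; exists z => //; apply: nbhsx_ballx.
pose D n := projT1 (cid2 (h n)).
have KD n : K `<=` cover [set` D n] (f n) by rewrite /D; case: cid2.
pose U i : set T := if @choice.unpickle (nat * nat)%type i is Some (n, j)
  then f n (nth z0 (D n) j) else set0.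
exists U; split.
  move=> i; rewrite /U; case: choice.unpickle => [[n j]|]; last exact: open0.
  exact: open_interior.
move=> x G Kx oG Gx.
have /nbhs_ballP[e /= e0 eG] : nbhs x G by exact: open_nbhs_nbhs.
(* Half of [e] is spent from [x] to the centre [w], half from [w] to [z]. *)
have [//|n] := @ltr_add_invr R 0 (e / 2) _; first by rewrite divr_gt0.
rewrite add0r => ne.
have [w /= wD fx] := KD n x Kx.
have wE : nth z0 (D n) (index w (D n)) = w by rewrite nth_index.
exists (choice.pickle (n, index w (D n))); rewrite /U choice.pickleK wE//.
apply: (subset_trans _ eG) => z bz; rewrite [e]splitr.
apply: (@ball_triangle _ _ w).
  by apply: (le_ball (ltW ne)); apply/ball_sym; apply: interior_subset.
by apply: (le_ball (ltW ne)); apply: interior_subset.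
Qed.

Section ultralimit.
Context (R : realType) (T : ptopologicalType) (K : set T).
Hypotheses (normT : normal_space T) (cptK : compact K) (clK : closed K).
Variable P_ : nat -> probability (borel T) R.
Hypothesis P_K : forall n, prob_on K (P_ n).

(** Each sequence [P_ n A] lies in [[0, 1]], so it converges along the ultrafilter. The setwise
    limit [L] may fail to be countably additive, but on closed sets it satisfies the requirements of
    the previous section. Inner regularization can only lower the value of an open set, whence a
    one-sided estimate. *)
Lemma ultralimit_probability (F : set_system nat) : UltraFilter F ->
  exists2 P : probability (borel T) R, prob_on K P &
    forall G, open G -> forall e : R, 0 < e ->
      \forall n \near F, (P G <= P_ n G + e%:E)%E.
Proof.
move=> UF; pose u (A : set T) n := fine (P_ n A).
have fP n (A : set (borel T)) : measurable A -> P_ n A \is a fin_num.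
  by move=> mA; exact: fin_num_measure.
have cv (A : set (borel T)) : measurable A -> cvg (u A @ F).
  move=> mA; have [//||p _ up] := @cvg_ultra_compact R nat F (u A) `[0, 1] UF.
  - exact: segment_compact.
  - apply: nearW => n /=; rewrite in_itv/= /u fine_ge0//=.
    by rewrite -lee_fin fineK ?fP// probability_le1.
  - by apply/cvg_ex; exists p.
pose L A := lim (u A @ F).
have cvL (A : set (borel T)) : measurable A -> u A @ F --> L A by exact: cv.
have le_lim (f g : nat -> R) a b : f @ F --> a -> g @ F --> b ->
    (forall n, f n <= g n) -> a <= b.
  by move=> fa gb fg; apply: (ler_cvg_to fa gb); exact: nearW.
have uU (A B : set (borel T)) : measurable A -> measurable B ->
    forall n, u (A `|` B) n <= u A n + u B n.
  move=> mA mB n; rewrite -lee_fin EFinD !fineK ?fP//; last exact: measurableU.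
  exact: measureU2.
have uUd (A B : set (borel T)) : measurable A -> measurable B ->
    A `&` B = set0 -> forall n, u A n + u B n = u (A `|` B) n.
  move=> mA mB AB n; rewrite /u -fineD ?fP//; congr fine.
  by rewrite measureU.
have u_le (A B : set (borel T)) : measurable A -> measurable B ->
    A `<=` B -> forall n, u A n <= u B n.
  move=> mA mB AB n; rewrite fine_le ?fP//.
  by apply: le_measure; rewrite ?inE.
have mC := @borel_closed T.
have L_T : L setT = 1.
  apply: cvg_lim => //; rewrite (_ : u setT = fun=> 1); first exact: cvg_cst.
  by apply/funext => n; rewrite /u probability_setT.
have L_0 : L set0 = 0.
  apply: cvg_lim => //; rewrite (_ : u set0 = fun=> 0); first exact: cvg_cst.
  by apply/funext => n; rewrite /u measure0.
have L_le C D : closed C -> closed D -> C `<=` D -> L C <= L D.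
  move=> /mC cC /mC cD CD.
  by apply: (le_lim _ _ _ _ (cvL _ cC) (cvL _ cD)); exact: u_le.
have L_U C D : closed C -> closed D -> L (C `|` D) <= L C + L D.
  move=> /mC cC /mC cD; have cCD := measurableU _ _ cC cD.
  apply: (le_lim _ _ _ _ (cvL _ cCD) (cvgD (cvL _ cC) (cvL _ cD))).
  exact: uU.
have L_Ud C D : closed C -> closed D -> C `&` D = set0 ->
    L C + L D <= L (C `|` D).
  move=> /mC cC /mC cD CD; have cCD := measurableU _ _ cC cD.
  apply: (le_lim _ _ _ _ (cvgD (cvL _ cC) (cvL _ cD)) (cvL _ cCD)) => n.
  by rewrite -uUd.
have L_I C : closed C -> L C <= L (C `&` K).
  move=> /mC cC; have cK := mC _ clK.
  apply: (le_lim _ _ _ _ (cvL _ cC) (cvL _ (measurableI _ _ cC cK))) => n.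
  by rewrite /u probability_setI1// P_K.
have [P hP] :=
  closed_content_probability normT cptK clK L_0 L_le L_U L_Ud L_I L_T.
(* A closed [C] outside [K] has empty trace on [K], so [L C] is at most [L set0], which is 0. *)
have PK0 : P (~` K) = 0%E.
  rewrite hP; last exact: closed_openC.
  apply/eqP; rewrite eq_le inner_content_ge0// andbT.
  apply: inner_content_le => C clC CK; rewrite -[leRHS]/(0%R%:E) -L_0 lee_fin.
  rewrite (_ : set0 = C `&` K); first exact: L_I.
  by apply/esym/disjoints_subset.
exists P.
  have mK := mC _ clK.
  rewrite /prob_on /= -(setCK K) probability_setC ?PK0 ?sube0//.
  exact: measurableC.
move=> G oG e e0.
have mG := borel_open oG.
(* [P G] is a supremum of [L C] over closed subsets [C] of [G], and [L] is monotone on Borel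
   sets. *)
have PGL : (P G <= (L G)%:E)%E.
  rewrite hP//; apply: inner_content_le => C clC CG; rewrite lee_fin.
  apply: (le_lim _ _ _ _ (cvL _ (mC _ clC)) (cvL _ mG)).
  exact: u_le (mC _ clC) mG CG.
have : \forall n \near F, L G - e < u G n.
  by apply: (cvgr_gt _ (cvL _ mG)); rewrite ltrBlDr ltrDl.
apply: filterS => n /ltW; rewrite lerBlDr => hn.
apply: le_trans PGL _.
by rewrite -[P_ n G]fineK ?fP// -EFinD lee_fin.
Qed.

(** One subsequence must serve all open sets at once. It is built by a diagonal choice over the
    countably many sets [W i]: the index [s k] controls [W 0], ..., [W k] up to [1/(k+1)]. On [K],
    an open set is an increasing union of such sets, so some [W i] inside it carries almost all of
    its [P]-mass. *)
Lemma open_liminf_subseq (U : (set T)^nat) : (forall i, open (U i)) ->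
  (forall x G, K x -> open G -> G x -> exists2 i, U i x & U i `<=` G) ->
  exists2 s : nat -> nat, {homo s : i j / (i < j)%N} &
    exists2 P : probability (borel T) R, prob_on K P &
      forall G, open G -> (P G <= limn_einf (fun k => P_ (s k) G))%E.
Proof.
move=> oU baseU.
have [F [UF ooF]] := @ultraFilterLemma nat \oo _.
have [P PK hP] := ultralimit_probability UF.
(* [W] enumerates the finite unions of members of the base. *)
pose W i :=
  \bigcup_(j in [set j | j \in odflt [::] (@choice.unpickle (seq nat) i)]) U j.
have oW i : open (W i) by apply: bigcup_open => j _; exact: oU.
(* Finitely many conditions hold together along [F], and [F] refines [\oo], so [n] can be taken
   beyond [m]. This makes [s] strictly increasing. *)
have step k m : exists n, (m < n)%N /\
    forall i, (i <= k)%N -> (P (W i) <= P_ n (W i) + (k.+1%:R^-1)%:E)%E.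
  have h1 : \forall n \near F, forall i : 'I_k.+1,
      (P (W i) <= P_ n (W i) + (k.+1%:R^-1)%:E)%E.
    by apply: filter_forall => i; apply: hP.
  have h2 : \forall n \near F, (m < n)%N by apply: ooF; exists m.+1.
  have [n [hn mn]] := filter_ex (filterI h1 h2).
  by exists n; split => // i ik; exact: (hn (Ordinal (ik : (i < k.+1)%N))).
pose g k m := projT1 (cid (step k m)).
have mg k m : (m < g k m)%N by rewrite /g; case: cid => ? [].
have hg k m i : (i <= k)%N ->
    (P (W i) <= P_ (g k m) (W i) + (k.+1%:R^-1)%:E)%E.
  by move=> ik; apply: (projT2 (cid (step k m))).2.
pose s := fix s k := if k is k'.+1 then g k (s k') else g 0%N 0%N.
have hs k i : (i <= k)%N ->
    (P (W i) <= P_ (s k) (W i) + (k.+1%:R^-1)%:E)%E.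
  by case: k => [|k'] ik; exact: hg.
exists s; first by apply: homo_ltn; [exact: ltn_trans|move=> i; exact: mg].
exists P => // G oG; apply: limn_einf_ge => e e0.
have e20 : 0 < e / 2 by rewrite divr_gt0.
have [i [WG PW]] : exists i, W i `<=` G /\ (P G <= P (W i) + (e / 2)%:E)%E.
  (* The first [n] members of the base, restricted to those inside [G]: a finite union, hence one of
     the [W i]. *)
  pose V n := \bigcup_(j in [set j | (j < n)%N /\ U j `<=` G]) U j.
  have oV n : open (V n) by apply: bigcup_open => j _; exact: oU.
  have VW n : exists i, W i = V n.
    exists (choice.pickle [seq j <- iota 0 n | `[< U j `<=` G >]]).
    rewrite /W choice.pickleK /=; apply: eq_bigcupl; split => j /=.
      by rewrite mem_filter mem_iota add0n => /andP[/asboolP ? ?].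
    by move=> [? ?]; rewrite mem_filter mem_iota add0n; apply/andP;
      split => //; apply/asboolP.
  have ndV : nondecreasing_seq (V : (set (borel T))^nat).
    move=> m n mn; apply/subsetPset => x [j /= [jm UG] Ux].
    by exists j => //=; split => //; exact: leq_trans mn.
  have mV n : measurable (V n : set (borel T)) by exact: borel_open.
  have moV : measurable (\bigcup_n V n : set (borel T)).
    by apply: borel_open; apply: bigcup_open => n _; exact: oV.
  (* [G] and the union of the [V n] have the same trace on [K], where [P] is concentrated. *)
  have PG : P G = P (\bigcup_n V n).
    have mK := borel_closed clK.
    rewrite -(@probability_setI1 _ _ R P K)//; last exact: borel_open.
    rewrite -[RHS](@probability_setI1 _ _ R P K)//; congr (P _).
    apply/seteqP; split => x [p Kx]; split => //.
      have [j Ujx UjG] := baseU x G Kx oG p.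
      by exists j.+1 => //; exists j => //=; split.
    by case: p => n _ [j /= [_ UG] Ujx]; exact: UG.
  have cvV : (P \o V) n @[n --> \oo] --> P (\bigcup_n V n).
    exact: nondecreasing_cvg_mu.
  have fPG : P (\bigcup_n V n) \is a fin_num by exact: fin_num_measure.
  have ndPV : nondecreasing_seq (P \o V).
    by move=> m n mn; apply: le_measure; rewrite ?inE//; apply/subsetPset/ndV.
  have supV : ereal_sup (range (P \o V)) = P (\bigcup_n V n).
    rewrite -(cvg_lim _ cvV)//; apply/esym/cvg_lim => //.
    exact: ereal_nondecreasing_cvgn.
  rewrite -supV in fPG.
  have [_ [n _ <-]] := ub_ereal_sup_adherent e20 fPG; rewrite supV => /ltW hn.
  have [i iV] := VW n; exists i; rewrite iV; split.
    by move=> x [j /= [_ UG] Ujx]; exact: UG.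
  by rewrite PG -leeBlDr.
have ek : \forall k \near \oo, (k.+1%:R^-1 : R) < e / 2.
  exact: near_infty_natSinv_lt (PosNum e20).
near=> k.
apply: le_trans PW _.
rewrite [e in leRHS]splitr EFinD addeA leeD2r//.
(* One [e / 2] paid for replacing [G] by [W i]; the other absorbs the error [1/(k+1)], valid as soon
   as [k] is at least [i]. *)
apply: (@le_trans _ _ (P_ (s k) (W i) + (k.+1%:R^-1)%:E)%E).
  by apply: hs; near: k; exists i.
apply: leeD; last by rewrite lee_fin ltW//; near: k.
by apply: le_measure; rewrite ?inE//; exact: borel_open.
Unshelve. all: by end_near. Qed.

End ultralimit.

(** * The portmanteau inequality *)

Lemma limn_einf_sup_einfs (R : realType) (u : (\bar R)^nat) :
  limn_einf u = ereal_sup (range (einfs u)).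
Proof. by rewrite limn_einf_lim (cvg_lim _ (@cvg_einfs_sup _ u)). Qed.

Lemma le_limn_einf (R : realType) (u v : (\bar R)^nat) :
  (forall n, (u n <= v n)%E) -> (limn_einf u <= limn_einf v)%E.
Proof.
move=> uv; rewrite !limn_einf_sup_einfs; apply: ge_ereal_sup => _ [N _ <-].
apply: (@le_trans _ _ (einfs v N)); last by apply: ereal_sup_ubound; exists N.
apply: le_ereal_inf_tmp => _ [k /= Nk <-].
by apply: le_trans (uv k); apply: ereal_inf_lbound; exists k.
Qed.

Lemma limn_einf_near_gt (R : realType) (u : (\bar R)^nat) (x : R) (e : R) :
  (x%:E <= limn_einf u)%E -> 0 < e ->
  \forall k \near \oo, ((x - e)%:E < u k)%E.
Proof.
move=> xu e0; have : ((x - e)%:E < limn_einf u)%E.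
  by apply: lt_le_trans xu; rewrite lte_fin ltrBlDr ltrDl.
rewrite limn_einf_sup_einfs => /ereal_sup_gt[_ [N _ <-]] h.
exists N => // k Nk; apply: (lt_le_trans h).
by apply: ereal_inf_lbound; exists k.
Qed.

(* Layer-cake formula and Fatou's lemma for the Lebesgue measure. *)
Lemma liminf_integral_superlevel d (T : measurableType d) (R : realType)
    (P_ : nat -> probability T R) (P : probability T R) (X : {mfun T >-> R}) :
  (forall z, 0 <= X z) ->
  (forall r, 0 <= r -> (P (X @^-1` `]r, +oo[) <=
                       limn_einf (fun k => P_ k (X @^-1` `]r, +oo[)))%E) ->
  (\int[P]_z (X z)%:E <= limn_einf (fun k => \int[P_ k]_z (X z)%:E))%E.
Proof.
move=> X0 h.
have ccdfE (Q : probability T R) : (\int[Q]_z (X z)%:E =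
    \int[lebesgue_measure]_(r in `[0%R, +oo[) Q (X @^-1` `]r, +oo[))%E.
  have := @ge0_expectation_ccdf _ _ R Q X X0.
  by rewrite expectation_def.
have mQ (Q : probability T R) :
    measurable_fun (`[0%R, +oo[ : set R) (fun r : R => Q (X @^-1` `]r, +oo[)).
  by apply: measurable_funTS; exact: (@ccdf_measurable _ _ R Q X).
under [X in limn_einf X]eq_fun do rewrite ccdfE.
have mL : measurable_fun (`[0%R, +oo[ : set R)
    (fun r : R => limn_einf (fun k => P_ k (X @^-1` `]r, +oo[))).
  (* [limn_einf] is minus the upper limit of the negatives, so measurability of upper limits
     applies. *)
  apply: (@measurableT_comp _ _ _ _ _ _ -%E) => //.
  apply: measurable_fun_limn_esup => n.
  by apply: (@measurableT_comp _ _ _ _ _ _ -%E).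
rewrite ccdfE.
apply: (@le_trans _ _ (\int[lebesgue_measure]_(r in `[0%R, +oo[)
    limn_einf (fun k => P_ k (X @^-1` `]r, +oo[)))%E); last first.
  by apply: fatou => // k; exact: mQ.
apply: ge0_le_integral => //; first exact: mQ.
by move=> r; rewrite /= in_itv/= andbT => r0; exact: h.
Qed.

Lemma lsc_within_open (R : realType) (T : topologicalType) (K : set T)
    (c : T -> \bar R) (a : R) :
  lower_semicontinuous (c : subspace K -> \bar R) ->
  exists2 G, open G & G `&` K = [set z | (a%:E < c z)%E] `&` K.
Proof. by move/lower_semicontinuousP => /(_ a)/open_subspaceP. Qed.

Lemma lsc_within_measurable (R : realType) (T : ptopologicalType) (K : set T)
    (c : T -> \bar R) : closed K ->
  lower_semicontinuous (c : subspace K -> \bar R) ->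
  measurable_fun (K : set (borel T)) c.
Proof.
move=> clK lc; apply: (measurability _ (ErealGenOInfty.measurableE R)).
move=> /= _ [_ [a ->]] <-; rewrite preimage_itvoy setIC.
have [G oG <-] := lsc_within_open a lc.
by apply: measurableI; [exact: borel_open|exact: borel_closed].
Qed.

Lemma within_continuous_lsc (R : realType) (T : topologicalType) (K : set T)
    (f : T -> R) : {within K, continuous f} ->
  lower_semicontinuous ((fun z => (f z)%:E) : subspace K -> \bar R).
Proof.
move=> cf x a; rewrite lte_fin => afx.
exists (f @^-1` [set y | a < y]); last by move=> y; rewrite lte_fin.
by apply: cf; exact: lt_nbhsr.
Qed.

Section portmanteau.
Context (R : realType) (T : ptopologicalType) (K : set T).
Hypothesis clK : closed K.
Variables (P_ : nat -> probability (borel T) R) (P : probability (borel T) R).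
Hypotheses (P_K : forall k, prob_on K (P_ k)) (PK : prob_on K P).
Hypothesis liminf_open : forall G, open G ->
  (P G <= limn_einf (fun k => P_ k G))%E.

Let mK : measurable (K : set (borel T)).
Proof. exact: borel_closed. Qed.

(** Truncating [c] at a level [M] gives a real function whose superlevel sets are traces of open
    sets on [K], so the layer-cake inequality applies to it. Monotone convergence in [M] then
    recovers [c], infinite values included. *)
Lemma lsc_integral_le_liminf (c : T -> \bar R) :
  (forall z, K z -> (0 <= c z)%E) ->
  lower_semicontinuous (c : subspace K -> \bar R) ->
  (\int[P]_(z in K) c z <= limn_einf (fun k => \int[P_ k]_(z in K) c z))%E.
Proof.
move=> c0 lc; have mc := lsc_within_measurable clK lc.
pose cM (M : nat) z := mine (c z) M%:R%:E.
have mcM M : measurable_fun (K : set (borel T)) (cM M).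
  by apply: measurable_mine => //; exact: measurable_cst.
have cM0 M z : K z -> (0 <= cM M z)%E.
  by move=> Kz; rewrite /cM le_min c0//= lee_fin.
have cMfin M z : K z -> cM M z \is a fin_num.
  move=> Kz; rewrite ge0_fin_numE ?cM0//.
  by rewrite /cM (@le_lt_trans _ _ M%:R%:E)// ?ge_min ?lexx ?orbT ?ltry.
have step M : (\int[P]_(z in K) cM M z <=
    limn_einf (fun k => \int[P_ k]_(z in K) c z))%E.
  (* Extension by 0 outside [K] keeps the superlevel sets for [r >= 0] inside [K]. *)
  pose X : borel T -> R := (fun z => fine (cM M z)) \_ K.
  have mX : measurable_fun setT X.
    apply/(measurable_restrictT _ _).1 => //.
    by apply: measurableT_comp.
  pose X' : {mfun borel T >-> R} := HB.pack X (isMeasurableFun.Build _ _ _ _ X mX).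
  have XE (Q : probability (borel T) R) :
      (\int[Q]_z (X' z)%:E = \int[Q]_(z in K) cM M z)%E.
    rewrite [RHS]integral_mkcond; apply: eq_integral => z _ /=.
    by rewrite /X !patchE; case: ifPn => // /set_mem Kz; rewrite fineK// cMfin.
  rewrite -XE; apply: (@le_trans _ _ (limn_einf (fun k => \int[P_ k]_z (X' z)%:E)%E)).
    apply: liminf_integral_superlevel.
      move=> z /=; rewrite /X patchE; case: ifPn => // /set_mem Kz.
      by rewrite fine_ge0// cM0.
    move=> r r0.
    (* Below [M] truncation does not change the superlevel set of [c]; from [M] on that of the
       truncation is empty. *)
    have [G oG XG] : exists2 G, open G & X' @^-1` `]r, +oo[ = G `&` K.
      have [rM|Mr] := ltP r M%:R.
        have [G oG GK] := lsc_within_open r lc; exists G => //.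
        rewrite GK; apply/seteqP; split => z /=; rewrite in_itv/= andbT /X patchE.
          case: ifPn => [/set_mem Kz|_]; last by rewrite ltNge r0.
          by rewrite -lte_fin fineK ?cMfin// /cM lt_min => /andP[].
        move=> [rc Kz]; rewrite mem_set// -lte_fin fineK ?cMfin//.
        by rewrite /cM lt_min rc lte_fin.
      exists set0; first exact: open0.
      rewrite set0I -subset0 => z /=; rewrite in_itv/= andbT /X patchE.
      case: ifPn => [/set_mem Kz|_]; last by rewrite ltNge r0.
      rewrite -lte_fin fineK ?cMfin// /cM lt_min lte_fin => /andP[_].
      by rewrite ltNge Mr.
    have mG : measurable (G : set (borel T)) by exact: borel_open.
    rewrite XG (probability_setI1 mK mG PK).
    under eq_fun do rewrite (probability_setI1 mK mG (P_K _)).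
    exact: liminf_open.
  apply: le_limn_einf => k; rewrite XE; apply: ge0_le_integral => // z Kz.
  - exact: cM0.
  - by rewrite /cM ge_min lexx.
have cvcM : (\int[P]_(z in K) cM M z)%E @[M --> \oo] -->
    (\int[P]_(z in K) c z)%E.
  rewrite (_ : (\int[P]_(z in K) c z)%E =
      (\int[P]_(z in K) (limn (cM ^~ z)))%E).
    apply: cvg_monotone_convergence => // z Kz m n mn.
    by rewrite /cM le_min !ge_min lexx/= lee_fin ler_nat mn orbT.
  (* The truncations are eventually constant where [c z] is finite and equal to [M] where it is
     infinite. *)
  apply: eq_integral => z /set_mem Kz; apply/esym/cvg_lim => //.
  have := c0 _ Kz; rewrite /cM; case: (c z) => [x x0||]//.
    apply: cvg_near_cst; near=> M; apply/min_idPl; rewrite lee_fin.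
    by near: M; exact: nbhs_infty_ger.
  move=> _; under eq_fun do rewrite minye.
  exact/cvgeryP/cvgr_idn.
by apply: (cvge_le _ cvcM); exact: nearW.
Unshelve. all: by end_near. Qed.

(** A bounded continuous function becomes nonnegative after adding a constant, so the lower
    semicontinuous inequality bounds its integrals from below. Applied to [f] and to [- f], this
    gives convergence. *)
Lemma liminf_open_weak_cvg : weak_cvg K P_ P.
Proof.
move=> f cf bf.
have mf : measurable_fun (K : set (borel T)) f.
  by apply/measurable_EFinP; exact: lsc_within_measurable (within_continuous_lsc cf).
have intf (Q : probability (borel T) R) : Q.-integrable K (EFin \o f).
  apply: measurable_bounded_integrable => //.
  exact: le_lt_trans (probability_le1 _ _) (ltry _).
have [M M0 fM] : exists2 M : R, 0 < M & forall z, K z -> `|f z| <= M.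
  have [M [_ h]] := bf; exists (`|M| + 1).
    by rewrite ltr_wpDl.
  move=> z Kz; apply: (h (`|M| + 1)) => //.
  by rewrite (le_lt_trans (ler_norm _))// ltrDl.
have key (g : T -> R) : {within K, continuous g} ->
    (forall Q : probability (borel T) R, Q.-integrable K (EFin \o g)) ->
    (forall z, K z -> `|g z| <= M) ->
    forall e : R, 0 < e -> \forall k \near \oo,
    \int[P]_(z in K) g z - e < \int[P_ k]_(z in K) g z.
  move=> cg intg gM e e0.
  have cgM : {within K, continuous (fun z => g z + M)}.
    by move=> z; apply: cvgD; [exact: cg|exact: cvg_cst].
  have gMc := within_continuous_lsc cgM.
  (* The shift adds the same [M] to every integral, since [K] has mass 1, and cancels in the
     comparison. *)
  have IE (Q : probability (borel T) R) : prob_on K Q ->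
      (\int[Q]_(z in K) (g z + M)%:E = (\int[Q]_(z in K) g z + M)%:E)%E.
    move=> QK; under eq_integral do rewrite EFinD.
    rewrite integralD//=; last first.
      apply: measurable_bounded_integrable => //.
      + exact: le_lt_trans (probability_le1 _ _) (ltry _).
      + by exists M; split=> [|x Mx z _]; rewrite ?num_real//= gtr0_norm// ltW.
    rewrite EFinD; congr (_ + _)%E.
      rewrite /Rintegral fineK//; exact: (integrable_fin_num mK (intg Q)).
    by rewrite integral_cst// -[RHS]mule1; congr (_ * _)%E.
  have := lsc_integral_le_liminf _ gMc; rewrite IE// => /(_ _)/limn_einf_near_gt h.
  have /h/(_ e0) : forall z, K z -> (0 <= (g z + M)%:E)%E.
    move=> z Kz; rewrite lee_fin -lerBlDr sub0r.
    by have := gM _ Kz; rewrite ler_norml => /andP[].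
  apply: filterS => k; rewrite IE// lte_fin => hk.
  by rewrite -(ltrD2r M) addrAC.
have IfE (Q : probability (borel T) R) :
    (\int[Q]_(z in K) (f z)%:E = (\int[Q]_(z in K) f z)%:E)%E.
  by rewrite /Rintegral fineK//; exact: (integrable_fin_num mK (intf Q)).
under eq_fun do rewrite IfE.
rewrite IfE; apply: cvg_EFin; first exact: nearW.
apply/cvgrPdist_lt => e e0.
have h1 := key f cf intf fM e e0.
have h2 : \forall k \near \oo,
    \int[P]_(z in K) (- f z) - e < \int[P_ k]_(z in K) (- f z).
  apply: key => //.
  - by move=> z; apply: cvgN; exact: cf.
  - by move=> Q; exact: (integrableN (intf Q)).
  - by move=> z Kz; rewrite normrN fM.
have NE (Q : probability (borel T) R) :
    \int[Q]_(z in K) (- f z) = - \int[Q]_(z in K) f z.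
  rewrite -[RHS]mulN1r -(RintegralZl _ mK (intf Q)).
  by apply: eq_Rintegral => z _; rewrite mulN1r.
near=> k; rewrite distrC ltr_distl; apply/andP; split; first by near: k.
have : \int[P]_(z in K) (- f z) - e < \int[P_ k]_(z in K) (- f z) by near: k.
rewrite !NE.
by rewrite ltrBlDr -ltrBlDl opprK addrC ltrBlDr => ?; rewrite addrC.
Unshelve. all: by end_near. Qed.

End portmanteau.

(** * Marginals of weak limits *)

(** Take the points whose ball of radius [1/(n+1)] stays in [G]. A point of the closure of this set
    lies in such a ball, hence still in [G]. *)
Lemma pseudometric_open_Fsigma (R : realType) (T : pseudoMetricType R)
    (G : set T) : open G ->
  exists C : (set T)^nat, [/\ forall n, closed (C n), nondecreasing_seq C &
    \bigcup_n C n = G].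
Proof.
move=> oG; pose D n := [set x : T | ball x n.+1%:R^-1 `<=` G].
exists (fun n => closure (D n)); split.
- by move=> n; exact: closed_closure.
- move=> m n mn; apply/subsetPset; apply: closureS => x; apply: subset_trans.
  by apply: le_ball; rewrite lef_pV2 ?posrE// ler_nat.
- apply/seteqP; split => x.
    move=> [n _ /(_ (ball x n.+1%:R^-1))[|y [Dy /ball_sym xy]]].
      exact: nbhsx_ballx.
    exact: Dy.
  move=> Gx; have /nbhs_ballP[e /= e0 eG] : nbhs x G by exact: open_nbhs_nbhs.
  have [//|n] := @ltr_add_invr R 0 e; rewrite add0r => /ltW ne.
  exists n => //; apply: subset_closure; apply: subset_trans eG.
  exact: le_ball.
Qed.

Lemma continuous_borel_measurable (T S : ptopologicalType) (p : T -> S) :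
  continuous p -> measurable_fun setT (p : borel T -> borel S).
Proof.
move=> /continuousP cp.
apply: (measurability _ (erefl (@measurable _ (borel S)))) => _ [B oB <-].
rewrite setTI; apply: (@borel_open T).
exact: cp.
Qed.

(** Change of variables, with domains. The preimage of [X] may exceed [K], but only by a [Q]-null
    set. The case where [p] is the identity compares integrals over two sets of full mass. *)
Lemma integral_image_measure d d' (T : measurableType d) (S : measurableType d')
    (R : realType) (Q : probability T R) (mu : probability S R)
    (K : set T) (X : set S) (p : T -> S) (f : S -> R) :
  measurable K -> measurable X -> measurable_fun setT p ->
  (forall z, K z -> X (p z)) -> Q K = 1%E ->
  (forall A, measurable A -> pushforward Q p A = mu A) ->
  measurable_fun X f -> [bounded f x | x in X] ->
  (\int[Q]_(z in K) (f (p z))%:E = \int[mu]_(x in X) (f x)%:E)%E.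
Proof.
move=> mK mX mp KX QK Qmu mf bf.
pose p' : {mfun T >-> S} := HB.pack p (isMeasurableFun.Build _ _ _ _ p mp).
pose nu : probability S R := distribution Q p'.
have mpX : measurable (p' @^-1` X).
  by rewrite -[_ @^-1` _]setTI; exact: (mp measurableT _ mX).
have -> : (\int[mu]_(x in X) (f x)%:E = \int[nu]_(x in X) (f x)%:E)%E.
  by apply: eq_measure_integral => A mA _; exact: (esym (Qmu A mA)).
(* [f] is measurable on [X] only; its extension by 0 is measurable everywhere. *)
pose g := f \_ X.
have mg : measurable_fun setT g by apply/(measurable_restrictT _ mX).1.
have gE x : X x -> g x = f x by move=> Xx; rewrite /g patchE mem_set.
have intgp : Q.-integrable (p' @^-1` X) ((EFin \o g) \o p').
  apply: (@measurable_bounded_integrable _ _ _ Q (g \o p')) => //.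
  - exact: le_lt_trans (probability_le1 _ _) (ltry _).
  - by apply: measurable_funTS; exact: measurableT_comp.
  - have [M [Mr h]] := bf; exists M; split => // x /h {}h z Xz /=.
    by rewrite gE//; exact: h.
transitivity (\int[nu]_(x in X) (EFin \o g) x)%E; last first.
  by apply: eq_integral => x /set_mem Xx; rewrite /= gE.
rewrite /nu /distribution integral_pushforward//; last exact/measurable_EFinP.
have QK0 : Q (~` K) = 0%E by rewrite probability_setC// QK subee.
have mKC := measurableC mK.
rewrite (negligible_integral mKC mpX intgp QK0).
rewrite setDE setCK setIC setIidl//.
by apply: eq_integral => z /set_mem Kz; rewrite /= gE//; exact: KX.
Qed.

(** Open sets are stable under intersection and generate the Borel sets, so agreement on them
    suffices. An open [G] is an increasing union of closed [C n], and a Urysohn function equal to 1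
    on [C n] and 0 off [G] lies between the two indicators. *)
Lemma probability_eq_continuous (R : realType) (S : ptopologicalType)
    (P Q : probability (borel S) R) : normal_space S ->
  (forall G : set S, open G -> exists C : (set S)^nat,
    [/\ forall n, closed (C n), nondecreasing_seq C & \bigcup_n C n = G]) ->
  (forall f : S -> R, continuous f -> (forall x, 0 <= f x <= 1) ->
    (\int[P]_x (f x)%:E = \int[Q]_x (f x)%:E)%E) ->
  forall A : set (borel S), measurable A -> P A = Q A.
Proof.
move=> nS sigS.
(* The inequality is proved for an arbitrary pair, then used in both orders. *)
suff key (P' Q' : probability (borel S) R) :
    (forall f : S -> R, continuous f -> (forall x, 0 <= f x <= 1) ->
      (\int[P']_x (f x)%:E = \int[Q']_x (f x)%:E)%E) ->
    forall G : set S, open G -> (P' G <= Q' G)%E.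
  move=> PQ A mA.
  apply: (@measure_unique _ R (borel S) (@open S) (fun=> setT)) => //.
  - by move=> B C; exact: openI.
  - by move=> _; exact: openT.
  - by rewrite bigcup_const.
  - move=> G oG; apply/eqP; rewrite eq_le; apply/andP; split.
      exact: key PQ _ oG.
    by apply: key oG => f cf f01; apply/esym/PQ.
  - by move=> _; rewrite (le_lt_trans (probability_le1 _ _))// ltry.
move=> PQ G oG; have [C [clC ndC CG]] := sigS G oG.
have mC n : measurable (C n : set (borel S)) by exact: borel_closed.
have cv : P' (C n) @[n --> \oo] --> P' G.
  rewrite -CG; apply: nondecreasing_cvg_mu => //.
  by rewrite CG; exact: borel_open.
apply: (cvge_le _ cv); apply: nearW => n.
have clG : closed (~` G) by exact: open_closedC.
have dis : ~` G `&` C n = set0.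
  by rewrite -subset0 => x [+ Cx]; apply; rewrite -CG; exists n.
have /(@uniform_separatorP _ R)[f [cf f01 f0 f1]] :=
  (@normal_separatorP R S).1 nS _ _ clG (clC n) dis.
have f01' x : 0 <= f x <= 1.
  have /f01 : range f (f x) by exists x.
  by rewrite /= in_itv.
have mf : measurable_fun (setT : set (borel S)) f.
  apply/measurable_EFinP.
  apply: (@lsc_within_measurable R S setT); first exact: closedT.
  by apply: within_continuous_lsc; exact: continuous_subspaceT.
apply: (@le_trans _ _ (\int[P']_x (f x)%:E)%E).
  rewrite -(setIT (C n)) -integral_indic//; apply: ge0_le_integral => //.
  - by apply/measurable_EFinP; exact: measurable_indic.
  - exact/measurable_EFinP.
  - move=> x _; rewrite lee_fin indicE; case: (boolP (x \in C n)) => [/set_mem Cx|_].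
      by rewrite (f1 (f x)) //; exists x.
    by have /andP[] := f01' x.
rewrite PQ// -(setIT G) -[leRHS]integral_indic//; last exact: borel_open.
apply: ge0_le_integral => //.
- by move=> x _; rewrite lee_fin; have /andP[] := f01' x.
- exact/measurable_EFinP.
- by apply/measurable_EFinP; apply: measurable_indic; exact: borel_open.
- move=> x _; rewrite lee_fin indicE; case: (boolP (x \in G)) => [_|/negP xG].
    by have /andP[] := f01' x.
  by rewrite (f0 (f x))//; exists x => //; move: xG; rewrite inE.
Qed.

(** By linearity the moment constraints give [v] equal integrals on both sides. Replacing [f] by [v]
    costs at most [e] under [Q] and [e] under [mu]. *)
Lemma span_moments_close d d' (T : measurableType d) (S : measurableType d')
    (R : realType) (Q : probability T R) (mu : probability S R)
    (K : set T) (X : set S) (p : T -> S) (phi : nat -> S -> R) (N : nat)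
    (v f : S -> R) (e : R) :
  measurable K -> measurable X -> measurable_fun setT p ->
  (forall z, K z -> X (p z)) -> Q K = 1%E -> mu X = 1%E ->
  (forall m, (1 <= m)%N -> measurable_fun X (phi m)) ->
  (forall m, (1 <= m)%N -> [bounded phi m x | x in X]) ->
  (forall m, (1 <= m <= N)%N -> (\int[Q]_(z in K) (phi m (p z))%:E =
    \int[mu]_(x in X) (phi m x)%:E)%E) ->
  span_upto phi N v -> measurable_fun X f -> [bounded f x | x in X] ->
  (forall x, X x -> `|f x - v x| <= e) ->
  `|\int[Q]_(z in K) (f (p z)) - \int[mu]_(x in X) f x| <= e + e.
Proof.
move=> mK mX mp KX QK muX mphi bphi moments [a ->] mf bf fve.
have intp (g : S -> R) : measurable_fun X g -> [bounded g x | x in X] ->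
    Q.-integrable K (EFin \o (g \o p)).
  move=> mg bg; apply: measurable_bounded_integrable => //.
  - exact: le_lt_trans (probability_le1 _ _) (ltry _).
  - apply: (measurable_comp (F := X)) => //; last exact: measurable_funTS.
    by move=> _ [z Kz <-]; exact: KX.
  - have [M [Mr h]] := bg; exists M; split => // x /h {}h z Kz.
    by apply: h; exact: KX.
have intX (g : S -> R) : measurable_fun X g -> [bounded g x | x in X] ->
    mu.-integrable X (EFin \o g).
  move=> mg bg; apply: measurable_bounded_integrable => //.
  exact: le_lt_trans (probability_le1 _ _) (ltry _).
have close d0 (U : measurableType d0) (P : probability U R) (D : set U)
    (g h : U -> R) : measurable D -> P D = 1%E ->
    P.-integrable D (EFin \o g) -> P.-integrable D (EFin \o h) ->
    (forall x, D x -> `|g x - h x| <= e) ->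
    `|\int[P]_(x in D) g x - \int[P]_(x in D) h x| <= e.
  move=> mD PD ig ih gh; rewrite -RintegralB//.
  have igh : P.-integrable D (EFin \o (fun x => g x - h x)).
    exact: (integrableB mD ig ih).
  apply: le_trans (le_normr_Rintegral mD igh) _.
  apply: (@le_trans _ _ (\int[P]_(_ in D) e)).
    apply: le_Rintegral => //; first exact: integrable_norm.
    by apply: finite_measure_integrable_cst.
  rewrite Rintegral_cst// -[leRHS]mulr1 le_eqVlt; apply/orP; left; apply/eqP.
  by congr (_ * _); rewrite -[RHS]/(fine 1%E); congr fine.
(* Partial sums of [v]: the induction stops at [N], the last index with a moment constraint. *)
pose V n (x : S) := \sum_(1 <= m < n.+1) a m * phi m x.
have HV n : (n <= N)%N -> [/\ Q.-integrable K (EFin \o (V n \o p)),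
    mu.-integrable X (EFin \o V n) &
    \int[Q]_(z in K) (V n (p z)) = \int[mu]_(x in X) V n x].
  elim: n => [|n IH] nN.
    have V0 : V 0%N = cst 0 by apply/funext => x; rewrite /V big_geq.
    rewrite V0; split.
    - exact: integrable0.
    - exact: integrable0.
    - by rewrite !Rintegral_cst// !mul0r.
  have [i1 i2 i3] := IH (ltnW nN).
  have VS : V n.+1 = (fun x => V n x + a n.+1 * phi n.+1 x).
    by apply/funext => x; rewrite /V big_nat_recr.
  have j1 : Q.-integrable K (EFin \o (fun z => a n.+1 * phi n.+1 (p z))).
    have ig : Q.-integrable K (EFin \o (phi n.+1 \o p)) by apply: intp; auto.
    exact: (integrableZl mK (a n.+1) ig).
  have j2 : mu.-integrable X (EFin \o (fun z => a n.+1 * phi n.+1 z)).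
    have ig : mu.-integrable X (EFin \o phi n.+1) by apply: intX; auto.
    exact: (integrableZl mX (a n.+1) ig).
  rewrite VS; split.
  - exact: (integrableD mK i1 j1).
  - exact: (integrableD mX i2 j2).
  - rewrite !RintegralD// i3; congr (_ + _).
    rewrite !RintegralZl//; last 2 first.
    + by apply: intX; auto.
    + by apply: (intp (phi n.+1)); auto.
    by congr (_ * _); rewrite /Rintegral moments.
have [i1 i2 i3] := HV N (leqnn _).
rewrite -(subrK (\int[Q]_(z in K) V N (p z)) (\int[Q]_(z in K) f (p z))) -addrA.
apply: le_trans (ler_normD _ _) _; apply: lerD.
  apply: close => //; first exact: intp.
  by move=> z Kz; apply: fve; exact: KX.
rewrite i3 distrC; apply: close => //.
exact: intX.
Qed.

(** For continuous [f], weak convergence sends the integrals of [f \o p] under [P_ (s k)] to that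
    under [P]. Density of the span together with the growing family of constraints sends them to the
    integral of [f] under [mu]. Uniqueness of limits identifies the two. *)
Lemma weak_limit_marginal (R : realType) (T S : ptopologicalType)
    (K : set T) (X : set S) (p : T -> S)
    (P_ : nat -> probability (borel T) R) (P : probability (borel T) R)
    (mu : probability (borel S) R) (phi : nat -> S -> R) (s : nat -> nat) :
  normal_space S ->
  (forall G : set S, open G -> exists C : (set S)^nat,
    [/\ forall n, closed (C n), nondecreasing_seq C & \bigcup_n C n = G]) ->
  closed K -> closed X -> continuous p -> (forall z, K z -> X (p z)) ->
  (forall N, (1 <= N)%N -> prob_on K (P_ N)) -> prob_on K P -> prob_on X mu ->
  (forall m, (1 <= m)%N -> measurable_fun (X : set (borel S)) (phi m)) ->
  (forall m, (1 <= m)%N -> [bounded phi m x | x in X]) ->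
  span_dense X phi ->
  (forall N m, (1 <= m <= N)%N -> (\int[P_ N]_(z in K) (phi m (p z))%:E =
    \int[mu]_(x in X) (phi m x)%:E)%E) ->
  (forall k, (1 <= s k)%N) -> {homo s : i j / (i < j)%N} ->
  weak_cvg K (fun k => P_ (s k)) P ->
  forall A : set (borel S), measurable A ->
    pushforward P (p : borel T -> borel S) A = mu A.
Proof.
move=> nS sigS clK clX cp KX P_K PK muX mphi bphi dphi moments s1 hs wc.
have mK := borel_closed clK; have mX := borel_closed clX.
have mp : measurable_fun setT (p : borel T -> borel S).
  exact: continuous_borel_measurable.
pose p' : {mfun borel T >-> borel S} :=
  HB.pack (p : borel T -> borel S)
    (isMeasurableFun.Build _ _ (borel T) (borel S) p mp).
pose nu : probability (borel S) R := distribution P p'.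
suff key : forall A : set (borel S), measurable A -> nu A = mu A by exact: key.
apply: probability_eq_continuous => // f cf f01.
have mf : measurable_fun (setT : set (borel S)) f.
  apply/measurable_EFinP.
  apply: (@lsc_within_measurable R S setT); first exact: closedT.
  by apply: within_continuous_lsc; exact: continuous_subspaceT.
have bf (D : set S) : [bounded f x | x in D].
  exists 1; split; rewrite ?num_real// => M M1 x _ /=.
  have /andP[f0 f1] := f01 x.
  by rewrite ger0_norm//; apply: le_trans f1 (ltW M1).
have -> : (\int[nu]_x (f x)%:E = \int[P]_(z in K) (f (p z))%:E)%E.
  by apply/esym/integral_image_measure.
have -> : (\int[mu]_x (f x)%:E = \int[mu]_(x in X) (f x)%:E)%E.
  exact/esym/(@integral_image_measure _ _ _ _ R mu mu X setT id).
have cfp : {within K, continuous (f \o p)}.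
  by apply: continuous_subspaceT => z; apply: continuous_comp; [exact: cp|exact: cf].
have bfp : [bounded (f \o p) z | z in K].
  exists 1; split; rewrite ?num_real// => M M1 x _ /=.
  have /andP[f0 f1] := f01 (p x).
  by rewrite ger0_norm//; apply: le_trans f1 (ltW M1).
have mfX : measurable_fun (X : set (borel S)) f by exact: measurable_funTS.
have IE (Q : probability (borel T) R) :
    (\int[Q]_(z in K) (f (p z))%:E = (\int[Q]_(z in K) (f (p z)))%:E)%E.
  rewrite /Rintegral fineK//; apply: (integrable_fin_num mK).
  apply: measurable_bounded_integrable => //.
    exact: le_lt_trans (probability_le1 _ _) (ltry _).
  by apply: measurable_funTS; apply: (measurableT_comp mf mp).
have IX : (\int[mu]_(x in X) (f x)%:E = (\int[mu]_(x in X) f x)%:E)%E.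
  rewrite /Rintegral fineK//; apply: (integrable_fin_num mX).
  apply: measurable_bounded_integrable => //.
  exact: le_lt_trans (probability_le1 _ _) (ltry _).
have wc' : (\int[P_ (s k)]_(z in K) (f (p z)))%:E @[k --> \oo] -->
    (\int[P]_(z in K) (f (p z)))%:E.
  by rewrite -IE; under eq_fun do rewrite -IE; exact: wc cfp bfp.
rewrite IE IX; apply: (cvg_unique _ wc') => //.
apply: cvg_EFin; first exact: nearW.
apply/cvgrPdist_le => e e0.
have e20 : 0 < e / 2 by rewrite divr_gt0.
have dinf := dphi f (continuous_subspaceT cf).
have : \forall N \near \oo, (ereal_inf
    [set sup_norm X (f \- v)%R | v in span_upto phi N] < (e / 2)%:E)%E.
  apply: (dinf [set x | (x < (e / 2)%:E)%E]); apply: open_nbhs_nbhs; split.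
    exact: open_ereal_lt_ereal.
  by rewrite /= lte_fin.
move=> [N0 _ hN0].
(* The plan [P_ (s k)] satisfies the constraints up to [s k], so approximation from the span at rank
   [s k] is admissible. *)
have le_s k : (k <= s k)%N.
  by elim: k => // k ih; apply: leq_ltn_trans ih (hs _ _ _).
exists N0 => // k /= N0k.
have [_ [v sv <-] hv] := ereal_inf_lt (hN0 (s k) (leq_trans N0k (le_s k))).
rewrite distrC [e]splitr.
apply: (span_moments_close mK mX mp KX (P_K _ (s1 k)) muX mphi bphi _ sv) => //.
  by move=> m mN; exact: moments.
move=> x Xx; rewrite -lee_fin; apply: le_trans (ltW hv).
by apply: ereal_sup_ubound; exists x.
Qed.

(** * Transport plans with moment constraints *)

Lemma limn_einf_le (R : realType) (u : (\bar R)^nat) (x : \bar R) :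
  (forall e : R, 0 < e -> \forall k \near \oo, (u k <= x + e%:E)%E) ->
  (limn_einf u <= x)%E.
Proof.
move=> h; rewrite limn_einf_sup_einfs; apply: ge_ereal_sup => _ [n _ <-].
apply/lee_addgt0Pr => e e0; have [N _ hN] := h e e0.
apply: le_trans (hN (maxn n N) _); last by rewrite /= leq_maxr.
by apply: ereal_inf_lbound; exists (maxn n N) => //=; rewrite leq_maxl.
Qed.

Section moment_constrained_transport.
Context (R : realType) (dx dy : nat).
Context (X : set 'rV[R]_dx) (Y : set 'rV[R]_dy).
Hypotheses (cptX : compact X) (cptY : compact Y).
Context (mu : probability (borel 'rV[R]_dx) R).
Context (nu : probability (borel 'rV[R]_dy) R).
Hypotheses (muX : prob_on X mu) (nuY : prob_on Y nu).
Context (phi : nat -> 'rV[R]_dx -> R) (psi : nat -> 'rV[R]_dy -> R).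
Hypothesis phi_meas : forall m, (1 <= m)%N ->
  measurable_fun (X : set (borel 'rV[R]_dx)) (phi m).
Hypothesis phi_bnd : forall m, (1 <= m)%N -> [bounded phi m x | x in X].
Hypothesis psi_meas : forall n, (1 <= n)%N ->
  measurable_fun (Y : set (borel 'rV[R]_dy)) (psi n).
Hypothesis psi_bnd : forall n, (1 <= n)%N -> [bounded psi n y | y in Y].

Let clX : closed X.
Proof. by apply: compact_closed => //; exact: norm_hausdorff. Qed.

Let clY : closed Y.
Proof. by apply: compact_closed => //; exact: norm_hausdorff. Qed.

Let cptK : compact (X `*` Y).
Proof. exact: compact_setX. Qed.

Let clK : closed (X `*` Y).
Proof. by apply: compact_closed => //; exact: norm_hausdorff. Qed.

Let cont_fst : continuous (fst : 'rV[R]_dx * 'rV[R]_dy -> 'rV[R]_dx).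
Proof. by move=> z; exact: cvg_fst. Qed.

Let cont_snd : continuous (snd : 'rV[R]_dx * 'rV[R]_dy -> 'rV[R]_dy).
Proof. by move=> z; exact: cvg_snd. Qed.

Lemma plans_sub_moment_plans N :
  plans X Y mu nu `<=` moment_plans X Y mu nu phi psi N.
Proof.
move=> P [PK P1 P2]; split => // m n /andP[m1 _] /andP[n1 _]; split.
- apply: (@integral_image_measure _ _ (borel ('rV[R]_dx * 'rV[R]_dy)%type)
    (borel 'rV[R]_dx) R P mu (X `*` Y) X fst) => //.
  + exact: (borel_closed clK).
  + exact: (borel_closed clX).
  + exact: continuous_borel_measurable.
  + by move=> z [].
  + exact: phi_meas.
  + exact: phi_bnd.
- apply: (@integral_image_measure _ _ (borel ('rV[R]_dx * 'rV[R]_dy)%type)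
    (borel 'rV[R]_dy) R P nu (X `*` Y) Y snd) => //.
  + exact: (borel_closed clK).
  + exact: (borel_closed clY).
  + exact: continuous_borel_measurable.
  + by move=> z [].
  + exact: psi_meas.
  + exact: psi_bnd.
Qed.

Hypotheses (phi_dense : span_dense X phi) (psi_dense : span_dense Y psi).

(** The cost is quantified after the subsequence: compactness and identification of the marginals do
    not depend on it. *)
Lemma moment_plans_subseq
    (pi : nat -> probability (borel ('rV[R]_dx * 'rV[R]_dy)%type) R) :
  (forall N, (1 <= N)%N -> moment_plans X Y mu nu phi psi N (pi N)) ->
  exists s : nat -> nat, [/\ forall k, (1 <= s k)%N,
    {homo s : i j / (i < j)%N} &
    exists P, [/\ prob_on (X `*` Y) P,
      weak_cvg (X `*` Y) (fun k => pi (s k)) P, plans X Y mu nu P &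
      forall c : 'rV[R]_dx * 'rV[R]_dy -> \bar R,
        (forall z, (X `*` Y) z -> (0 <= c z)%E) ->
        lower_semicontinuous (c : subspace (X `*` Y) -> \bar R) ->
        (cost X Y c P <= limn_einf (fun k => cost X Y c (pi (s k))))%E]].
Proof.
move=> hpi.
have [U [oU baseU]] := @compact_countable_base R
  ('rV[R]_dx * 'rV[R]_dy)%type _ cptK.
have piK N : (1 <= N)%N -> prob_on (X `*` Y) (pi N) by move=> /hpi[].
have nK : normal_space ('rV[R]_dx * 'rV[R]_dy)%type.
  exact: (@pseudometric_normal R).
(* The constraints start at [N = 1], so the sequence is shifted by one, and the extracted indices
   are [(s k).+1]. *)
have [s hs [P PK hP]] := @open_liminf_subseq R _ (X `*` Y) nK cptK clK
  (fun n => pi n.+1) (fun n => piK n.+1 isT) U oU baseU.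
have hs1 : {homo (fun k => (s k).+1) : i j / (i < j)%N}.
  by move=> i j ij; exact: hs.
exists (fun k => (s k).+1); split => //.
have wc : weak_cvg (X `*` Y) (fun k => pi (s k).+1) P.
  by apply: liminf_open_weak_cvg => // k; exact: piK.
exists P; split => //; last first.
  move=> c c0 lc; apply: lsc_integral_le_liminf => // k; exact: piK.
split => //.
- apply: (@weak_limit_marginal R _ _ (X `*` Y) X fst pi P mu phi
    (fun k => (s k).+1)) => //.
  + exact: (@pseudometric_normal R).
  + exact: (@pseudometric_open_Fsigma R).
  + by move=> z [].
  + move=> N m /andP[m1 mN]; have N1 := leq_trans m1 mN.
    have [_ h] := hpi N N1.
    (* The constraints on [phi] and [psi] come in pairs; the second index is set to [m]. *)
    by have [] := h m m; rewrite ?m1 ?mN.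
- apply: (@weak_limit_marginal R _ _ (X `*` Y) Y snd pi P nu psi
    (fun k => (s k).+1)) => //.
  + exact: (@pseudometric_normal R).
  + exact: (@pseudometric_open_Fsigma R).
  + by move=> z [].
  + move=> N m /andP[m1 mN]; have N1 := leq_trans m1 mN.
    have [_ h] := hpi N N1.
    by have [] := h m m; rewrite ?m1 ?mN.
Qed.

End moment_constrained_transport.

(** * Convergence of the constrained values and of near-minimizers *)

Theorem proposition4p2 (R : realType) (dx dy : nat)
  (dx_gt0 : (0 < dx)%N) (dy_gt0 : (0 < dy)%N)
  (X : set 'rV[R]_dx) (Y : set 'rV[R]_dy)
  (cptX : compact X) (cptY : compact Y)
  (mu : probability (borel 'rV[R]_dx) R) (muX : prob_on X mu)
  (nu : probability (borel 'rV[R]_dy) R) (nuY : prob_on Y nu)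
  (c : 'rV[R]_dx * 'rV[R]_dy -> \bar R)
  (c_ge0 : forall z, (X `*` Y) z -> (0 <= c z)%E)
  (c_lsc : lower_semicontinuous (c : subspace (X `*` Y) -> \bar R))
  (phi : nat -> 'rV[R]_dx -> R) (psi : nat -> 'rV[R]_dy -> R)
  (phi_meas : forall m, (1 <= m)%N ->
     measurable_fun (X : set (borel 'rV[R]_dx)) (phi m))
  (phi_bnd : forall m, (1 <= m)%N -> [bounded phi m x | x in X])
  (psi_meas : forall n, (1 <= n)%N ->
     measurable_fun (Y : set (borel 'rV[R]_dy)) (psi n))
  (psi_bnd : forall n, (1 <= n)%N -> [bounded psi n y | y in Y])
  (phi_dense : span_dense X phi) (psi_dense : span_dense Y psi)
  (I_fin : (ot_value X Y mu nu c < +oo)%E) :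
  [/\ forall N, (1 <= N)%N ->
        (mc_value X Y mu nu c phi psi N <= ot_value X Y mu nu c)%E,
      mc_value X Y mu nu c phi psi @ \oo --> ot_value X Y mu nu c &
      forall (pi : nat -> probability (borel ('rV[R]_dx * 'rV[R]_dy)%type) R)
        (eps : nat -> R),
        (forall N, (1 <= N)%N -> moment_plans X Y mu nu phi psi N (pi N)) ->
        (forall N, (1 <= N)%N ->
           (cost X Y c (pi N) <= mc_value X Y mu nu c phi psi N + (eps N)%:E)%E) ->
        eps @ \oo --> (0 : R) ->
        exists s : nat -> nat,
          [/\ forall k, (1 <= s k)%N, {homo s : i j / (i < j)%N} &
            exists pi_oo : probability (borel ('rV[R]_dx * 'rV[R]_dy)%type) R,
              [/\ prob_on (X `*` Y) pi_oo,
                  weak_cvg (X `*` Y) (fun k => pi (s k)) pi_oo,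
                  plans X Y mu nu pi_oo &
                  cost X Y c pi_oo = ot_value X Y mu nu c]]].
Proof.
set I := ot_value X Y mu nu c; set J := mc_value X Y mu nu c phi psi.
have JI N : (J N <= I)%E.
  by apply: ereal_inf_le_tmp; apply: image_subset; exact: plans_sub_moment_plans.
have J_ge0 N : (0 <= J N)%E.
  by apply: le_ereal_inf_tmp => _ [P _ <-]; apply: integral_ge0.
have J_fin N : J N \is a fin_num.
  by rewrite ge0_fin_numE// (le_lt_trans (JI N)).
(* The constraint sets shrink as [N] grows. *)
have J_nd : nondecreasing_seq J.
  move=> m n mn; apply: ereal_inf_le_tmp; apply: image_subset => P [PK h].
  split => // i j /andP[i1 im] /andP[j1 jm].
  by apply: h; rewrite ?i1 ?j1 (leq_trans _ mn).
(* The range of [J] includes [J 0], where no moment is constrained; by monotonicity this leaves the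
   supremum unchanged. *)
have J_sup := ereal_nondecreasing_cvgn J_nd.
(* The bound is by the supremum of [J] and not by [I], so that the claim can first be used to prove
   that the two agree and then for the given sequence. *)
have limit (pi : nat -> probability (borel ('rV[R]_dx * 'rV[R]_dy)%type) R)
    (eps : nat -> R) :
    (forall N, (1 <= N)%N -> moment_plans X Y mu nu phi psi N (pi N)) ->
    (forall N, (1 <= N)%N -> (cost X Y c (pi N) <= J N + (eps N)%:E)%E) ->
    eps @ \oo --> (0 : R) ->
    exists s : nat -> nat, [/\ forall k, (1 <= s k)%N,
      {homo s : i j / (i < j)%N} &
      exists P, [/\ prob_on (X `*` Y) P,
        weak_cvg (X `*` Y) (fun k => pi (s k)) P, plans X Y mu nu P &
        (cost X Y c P <= ereal_sup (range J))%E]].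
  move=> hpi hcost eps0.
  have [s [s1 hs [P [PK wc PP hP]]]] := moment_plans_subseq cptX cptY muX nuY
    phi_meas phi_bnd psi_meas psi_bnd phi_dense psi_dense hpi.
  exists s; split => //; exists P; split => //.
  apply: le_trans (hP c c_ge0 c_lsc) _; apply: limn_einf_le => e e0.
  have [N0 _ hN0] : \forall N \near \oo, eps N < e.
    by apply: (cvgr_lt _ eps0).
  have le_s k : (k <= s k)%N.
    by elim: k => // k ih; apply: leq_ltn_trans ih (hs _ _ _).
  exists N0 => // k /= N0k; apply: le_trans (hcost _ (s1 k)) _.
  apply: leeD; first by apply: ereal_sup_ubound; exists (s k).
  by rewrite lee_fin ltW//; apply: hN0; exact: leq_trans (le_s k).
have supI : ereal_sup (range J) = I.
  apply/eqP; rewrite eq_le; apply/andP; split.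
    by apply: ge_ereal_sup => _ [N _ <-].
  (* Near-minimizers with error [1/(N+1)] exist because [J N] is finite. Their limit is a genuine
     transport plan, so its cost is at least [I]. *)
  have approx N : exists P, moment_plans X Y mu nu phi psi N P /\
      (cost X Y c P <= J N + (N.+1%:R^-1)%:E)%E.
    have N0 : 0 < N.+1%:R^-1 :> R by [].
    have [_ [P PM <-] /ltW h] := lb_ereal_inf_adherent N0 (J_fin N).
    by exists P.
  have [s [_ _ [P [_ _ PP]]]] := limit (fun N => projT1 (cid (approx N)))
    (fun N => N.+1%:R^-1) (fun N _ => (projT2 (cid (approx N))).1)
    (fun N _ => (projT2 (cid (approx N))).2) (@cvg_harmonic R).
  by apply: le_trans; apply: ereal_inf_lbound; exists P.
split => //; first by rewrite -supI.
move=> pi eps hpi hcost eps0.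
have [s [s1 hs [P [PK wc PP hP]]]] := limit pi eps hpi hcost eps0.
exists s; split => //; exists P; split => //.
apply/eqP; rewrite eq_le -{1}supI hP/=.
by apply: ereal_inf_lbound; exists P.
Qed.
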